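(* Let $D=(V(D),E(D))$ be a simple digraph on $n\geq 2$ vertices with $V(D)=\{1,2,\ldots,n\}$ and outdegree sequence $d_1^+\geq d_2^+\geq\cdots\geq d_n^+$, where $d_i^+$ is the outdegree of vertex $i$. Let $\phi_1=2d_1^+$ and, for $2\leq l\leq n$, $$\phi_l=\frac{d_1^++2d_l^+-1+\sqrt{(2d_l^+-d_1^++1)^2+8\sum_{i=1}^{l-1}(d_i^+-d_l^+)}}{2}.$$ Let $s\in\{1,2,\ldots,n\}$ be such that $\phi_s=\min_{1\leq l\leq n}\phi_l$. Then $q(D)\leq\phi_s$. Furthermore, if $D$ is strongly connected, then $q(D)=\phi_s$ if and only if either $D$ is regular (i.e. $d_1^+=\cdots=d_n^+$), or there exists an integer $t$ with $2\leq t\leq s$ such that $d_1^+=\cdots=d_{t-1}^+>d_t^+=\cdots=d_n^+$ and the indegrees satisfy $d_1^-=\cdots=d_{t-1}^-=n-1$.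
   Context: Digraphs are finite; a digraph is simple if it has no loops and no multiple arcs. The outdegree $d_i^+$ (indegree $d_i^-$) of vertex $i$ is the number of arcs leaving (entering) $i$. For a digraph $D$ with adjacency matrix $A(D)=(a_{ij})$ ($a_{ij}$ is the number of arcs $(i,j)$), the signless Laplacian matrix is $Q(D)=\mathrm{diag}(d_1^+,\ldots,d_n^+)+A(D)$, and $q(D)$ denotes its spectral radius (the largest modulus of its eigenvalues). *)

(* Defs.v *)
From mathcomp Require Import all_boot all_order all_algebra.
From mathcomp Require Import classical_sets reals complex.

Set Implicit Arguments.
Unset Strict Implicit.
Unset Printing Implicit Defensive.

Import Order.TTheory GRing.Theory Num.Theory.
Local Open Scope ring_scope.
Local Open Scope classical_set_scope.
Local Open Scope complex_scope.

(* A digraph without multiple arcs on n vertices is its arc relation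
   E : rel 'I_n; it is simple when E is moreover irreflexive. Vertices and
   degree sequences are indexed from 0. *)

Definition outdegree n (E : rel 'I_n) (i : 'I_n) : nat := #|[set j | E i j]%SET|.

Definition indegree n (E : rel 'I_n) (i : 'I_n) : nat := #|[set j | E j i]%SET|.

Definition strongly_connected n (E : rel 'I_n) : Prop :=
  forall i j, connect E i j.

Definition adjacency_mx (K : nzRingType) n (E : rel 'I_n) : 'M[K]_n :=
  \matrix_(i, j) (E i j)%:R.

Definition signless_laplacian (K : nzRingType) n (E : rel 'I_n) : 'M[K]_n :=
  diag_mx (\row_i (outdegree E i)%:R) + adjacency_mx K E.

Section SpectralRadius.
Variable R : realType.

Definition spectral_radius n (M : 'M[R[i]]_n) : R :=
  sup [set Normc.normc z | z in [set z | eigenvalue M z]].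

(* For n > 0 the supremum is a maximum. *)
Lemma spectral_radius_max n (M : 'M[R[i]]_n.+1) :
  (exists2 z, eigenvalue M z & Normc.normc z = spectral_radius M) /\
  (forall z, eigenvalue M z -> Normc.normc z <= spectral_radius M).
Proof.
have [r Dp] := closed_field_poly_normal (char_poly M).
have mem_r z : eigenvalue M z = (z \in r).
  rewrite eigenvalue_root_char Dp rootZ ?root_prod_XsubC //.
  by rewrite lead_coef_eq0 monic_neq0 // char_poly_monic.
have r0 : r != [::].
  apply/eqP => r0; have := size_char_poly M.
  by rewrite Dp r0 big_nil (monicP (char_poly_monic M)) scale1r size_poly1.
have [z0 z0r z0max] : exists2 z0, z0 \in r &
    forall z, z \in r -> Normc.normc z <= Normc.normc z0.
  elim: r r0 {Dp mem_r} => // a [|b s] IH _.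
    by exists a => [|z]; rewrite inE // => /eqP->.
  have [//|c cs cmax] := IH; have [ac|/ltW ca] := leP (Normc.normc a) (Normc.normc c).
    by exists c => [|z]; rewrite inE ?cs ?orbT // => /predU1P[->//|/cmax].
  exists a => [|z]; rewrite inE ?eqxx // => /predU1P[->//|/cmax zc].
  exact: le_trans zc ca.
have ubz0 : ubound [set Normc.normc z | z in [set z | eigenvalue M z]]
    (Normc.normc z0) by move=> _ [z + <-] => /=; rewrite mem_r => /z0max.
have z0S : [set Normc.normc z | z in [set z | eigenvalue M z]] (Normc.normc z0).
  by exists z0 => //=; rewrite mem_r.
have Dq : Normc.normc z0 = spectral_radius M.
  apply/eqP; rewrite eq_le ge_sup ?andbT //; last by exists (Normc.normc z0).
  by apply: ub_le_sup => //; exists (Normc.normc z0).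
split; first by exists z0; rewrite ?mem_r.
by move=> z; rewrite mem_r -Dq => /z0max.
Qed.

Definition signless_spectral_radius n (E : rel 'I_n) : R :=
  spectral_radius (signless_laplacian R[i] E).

Definition phi n (d : 'I_n.+1 -> nat) (l : 'I_n.+1) : R :=
  let d1 : R := (d ord0)%:R in
  let dl : R := (d l)%:R in
  if l == ord0 then 2 * d1
  else (d1 + 2 * dl - 1 +
        Num.sqrt ((2 * dl - d1 + 1) ^+ 2
                  + 8 * \sum_(i < n.+1 | (i < l)%N) ((d i)%:R - dl))) / 2.

End SpectralRadius.

(* Main.v *)
(** For fixed [l] put [c = 2 / (phi_l - d_1 + 1)] and [x_i = 1 + c (d_i - d_l)]
    (truncated subtraction). As [phi_l] is the larger root of
    [(z - 2 d_l) (z - d_1 + 1) = 2 sum_i (d_i - d_l)], the vector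
    [phi_l x - Q x] is an explicit nonnegative slack. Pairing it with the
    vector of moduli of a left eigenvector of [Q] gives [q <= phi_l]. If [D] is
    strongly connected and equality holds, this vector of moduli is a positive
    left eigenvector, so every slack vanishes; the vanishing of all slacks is
    the stated degree condition. Conversely, vanishing slacks make [phi_l] an
    eigenvalue. *)
Require Import Defs.
From mathcomp Require Import all_boot all_order all_algebra.
From mathcomp Require Import reals complex.
From mathcomp Require Import lra ring.

Import Order.TTheory GRing.Theory Num.Theory.

Local Open Scope ring_scope.

(** * Eigenvalue moduli of nonnegative matrices *)

Section NonnegativeMatrix.
Context {R : realType} {n : nat}.
Implicit Types (M : 'M[R]_n) (x : 'I_n -> R).

Let toC := map_mx (real_complex R) : 'M[R]_n -> 'M[R[i]]_n.

Lemma normc_ge0 (z : R[i]) : 0 <= Normc.normc z.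
Proof. by case: z => a b; exact: sqrtr_ge0. Qed.

(** This is the triangle inequality applied to coordinate [j] of [v M = z v], the entries of [M]
    being their own moduli. *)
Lemma left_eigenvector_norm M (v : 'rV[R[i]]_n) z j :
  (forall i k, 0 <= M i k) -> v *m toC M = z *: v ->
  Normc.normc z * Normc.normc (v 0 j) <= \sum_i Normc.normc (v 0 i) * M i j.
Proof.
move=> M_ge0 /matrixP/(_ 0 j); rewrite !mxE => Dv.
rewrite -lecR rmorphM /= rmorph_sum /=.
have -> : (Normc.normc z)%:C%C * (Normc.normc (v 0 j))%:C%C = `|z * v 0 j|.
  by rewrite normrM.
rewrite -Dv (le_trans (ler_norm_sum _ _ _))// ler_sum// => i _.
rewrite normrM mxE rmorphM /= ler_wpM2l// normc_def /= expr0n addr0.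
by rewrite sqrtr_sqr ger0_norm.
Qed.

Lemma left_eigenvector_weighted_norm M (v : 'rV[R[i]]_n) z x :
  (forall i k, 0 <= M i k) -> (forall i, 0 <= x i) -> v *m toC M = z *: v ->
  Normc.normc z * \sum_j Normc.normc (v 0 j) * x j <=
    \sum_i Normc.normc (v 0 i) * \sum_j M i j * x j.
Proof.
move=> M_ge0 x_ge0 vM; rewrite mulr_sumr.
rewrite [leRHS](eq_bigr (fun i => \sum_j Normc.normc (v 0 i) * M i j * x j)); last first.
  by move=> i _; rewrite mulr_sumr; apply: eq_bigr => j _; rewrite mulrA.
rewrite [leRHS]exchange_big ler_sum// => j _.
by rewrite -mulr_suml mulrA ler_wpM2r// left_eigenvector_norm.
Qed.

Lemma weighted_norm_gt0 (v : 'rV[R[i]]_n) x :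
  (forall i, 0 < x i) -> v != 0 -> 0 < \sum_j Normc.normc (v 0 j) * x j.
Proof.
move=> x_gt0 v_neq0.
have term_ge0 j : 0 <= Normc.normc (v 0 j) * x j.
  by rewrite mulr_ge0 ?normc_ge0// ltW.
rewrite lt_def sumr_ge0// andbT.
apply: contraNneq v_neq0 => /eqP; rewrite psumr_eq0// => /allP v0.
apply/eqP/rowP => j; rewrite mxE.
have := v0 j; rewrite mem_index_enum mulf_eq0 (gt_eqF (x_gt0 j)) orbF.
by move=> /(_ isT)/eqP/Normc.eq0_normc.
Qed.

(** Let [w] hold the moduli of a left eigenvector for [z]. Then
    [|z| <w, x> <= <w, M x> <= r <w, x>], and [<w, x>] can be cancelled because [x] is positive. *)
Lemma eigenvalue_norm_le M x r z :
  (forall i k, 0 <= M i k) -> (forall i, 0 < x i) ->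
  (forall i, \sum_j M i j * x j <= r * x i) ->
  eigenvalue (toC M) z -> Normc.normc z <= r.
Proof.
move=> M_ge0 x_gt0 Mx /eigenvalueP[v vM v_neq0].
rewrite -(ler_pM2r (weighted_norm_gt0 _ _ x_gt0 v_neq0)).
apply: le_trans (left_eigenvector_weighted_norm _ _ _ _ M_ge0 _ vM) _.
  by move=> i; exact: ltW.
rewrite mulr_sumr ler_sum// => i _; rewrite mulrCA ler_wpM2l//.
exact: normc_ge0.
Qed.

(** With [r = |z|] the chain of inequalities behind [eigenvalue_norm_le] is tight, so every gap in
    it vanishes. In particular [w] is a left eigenvector for [|z|], and connectedness makes it
    positive, so the gaps of [M x <= |z| x] cannot be hidden by zero weights. *)
Lemma eigenvalue_norm_eq M x z (E : rel 'I_n) :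
  (forall i k, 0 <= M i k) -> (forall i, 0 < x i) ->
  (forall i j, E i j -> 0 < M i j) -> (forall i j, connect E i j) ->
  (forall i, \sum_j M i j * x j <= Normc.normc z * x i) ->
  eigenvalue (toC M) z ->
  forall i, \sum_j M i j * x j = Normc.normc z * x i.
Proof.
move=> M_ge0 x_gt0 EM Econ Mx /eigenvalueP[v vM v_neq0].
pose w j := Normc.normc (v 0 j).
have w_ge0 j : 0 <= w j := normc_ge0 (v 0 j).
have wM j : Normc.normc z * w j <= \sum_i w i * M i j.
  exact: left_eigenvector_norm.
have sumE : \sum_j (\sum_i w i * M i j) * x j =
            \sum_i w i * \sum_j M i j * x j.
  under eq_bigr do rewrite mulr_suml.
  rewrite exchange_big; apply: eq_bigr => i _; rewrite mulr_sumr.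
  by apply: eq_bigr => j _; rewrite mulrA.
pose a j := (\sum_i w i * M i j - Normc.normc z * w j) * x j.
pose b i := w i * (Normc.normc z * x i - \sum_j M i j * x j).
have a_ge0 j : 0 <= a j by rewrite mulr_ge0 ?subr_ge0// ltW.
have b_ge0 i : 0 <= b i by rewrite mulr_ge0 ?subr_ge0.
(* The sums are [<w M, x> - |z| <w, x>] and [|z| <w, x> - <w, M x>], which are opposite. *)
have ab0 : \sum_j a j + \sum_j b j = 0.
  rewrite /a /b; under eq_bigr do rewrite mulrBl.
  under [X in _ + X]eq_bigr do rewrite mulrBr.
  rewrite !sumrB sumE.
  under [X in _ - X + _]eq_bigr do rewrite mulrAC mulrC.
  by rewrite addrA subrK subrr.
have /andP[/allP a0 /allP b0] : all (fun j => true ==> (a j == 0)) (index_enum _)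
    && all (fun j => true ==> (b j == 0)) (index_enum _).
  by rewrite -!psumr_eq0// -paddr_eq0 ?sumr_ge0// ab0.
have wE j : \sum_i w i * M i j = Normc.normc z * w j.
  have := a0 j; rewrite mem_index_enum mulf_eq0 (gt_eqF (x_gt0 j)) orbF subr_eq0.
  by move=> /(_ isT)/eqP.
(* If [w j] were 0, the nonnegative terms of [(w M) j = |z| w j] would all vanish, among them
   [w i * M i j]. *)
have w_step i j : E i j -> 0 < w i -> 0 < w j.
  move=> Eij wi; rewrite lt_def w_ge0 andbT; apply/eqP => wj0.
  have := wE j; rewrite wj0 mulr0 => /eqP; rewrite psumr_eq0; last first.
    by move=> k _; rewrite mulr_ge0.
  move=> /allP/(_ i); rewrite mem_index_enum => /(_ isT).
  by rewrite mulf_eq0 (gt_eqF wi) (gt_eqF (EM _ _ Eij)).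
have [i0 wi0] : exists i, 0 < w i.
  have /rV0Pn[i vi] := v_neq0; exists i; rewrite lt_def w_ge0 andbT.
  by apply: contraNneq vi => /Normc.eq0_normc->.
have w_gt0 j : 0 < w j.
  have /connectP[p Ep ->] := Econ i0 j.
  elim: p i0 wi0 Ep => //= k p IH i wi /andP[Eik]; apply: IH.
  exact: w_step Eik wi.
move=> i; have := b0 i; rewrite mem_index_enum mulf_eq0 (gt_eqF (w_gt0 i)) subr_eq0.
by move=> /(_ isT)/eqP.
Qed.

(** [eigenvalue] refers to row vectors while [x] acts as a column, so the passage is through
    singularity: an invertible [M - r] could not annihilate [x]. *)
Lemma eigenvalue_of_right_eigenvector M x r :
  (exists i, x i != 0) -> (forall i, \sum_j M i j * x j = r * x i) ->
  eigenvalue (toC M) r%:C%C.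
Proof.
move=> [i xi] Mx; rewrite /eigenvalue /eigenspace kermx_eq0 row_free_unit.
pose u := \col_k x k.
have Mu : (M - r%:M) *m u = 0.
  apply/colP => k; rewrite mulmxBl mul_scalar_mx !mxE -Mx.
  by under eq_bigr do rewrite mxE; rewrite subrr.
apply/negP => inv_M.
have /(congr1 (map_mx (real_complex R))) := Mu.
rewrite map_mxM map_mxB map_scalar_mx map_mx0 /=.
move=> /(congr1 (mulmx (invmx (toC M - r%:C%C%:M)))).
rewrite mulKmx// mulmx0 => /colP/(_ i); rewrite !mxE => /eqP.
by rewrite fmorph_eq0 (negPf xi).
Qed.

End NonnegativeMatrix.

(** * [phi] as a root of a quadratic *)

Section Phi.
Context {R : realType} {n : nat}.
Variable d : 'I_n.+1 -> nat.
Hypothesis d_sorted : forall i j : 'I_n.+1, (i <= j)%N -> (d j <= d i)%N.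
Variable l : 'I_n.+1.

Let S := (\sum_i (d i - d l))%N.

Lemma truncated_sumE :
  \sum_(i < n.+1 | (i < l)%N) ((d i)%:R - (d l)%:R) = S%:R :> R.
Proof.
rewrite natr_sum big_mkcond; apply: eq_bigr => i _.
case: ltnP => il; first by rewrite natrB// d_sorted// ltnW.
by have := d_sorted _ _ il; rewrite -subn_eq0 => /eqP->.
Qed.

(** This makes the scale [c] of the test vector well defined and positive. *)
Lemma phi_sub_gt0 : 0 < phi R d l - (d ord0)%:R + 1.
Proof.
suff: (d ord0)%:R - 1 < phi R d l by lra.
have d1_ge0 : 0 <= (d ord0)%:R :> R by [].
have S_ge : (d ord0)%:R - (d l)%:R <= S%:R :> R.
  by rewrite -natrB ?d_sorted// ler_nat /S (bigD1 ord0)//= leq_addr.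
rewrite /phi truncated_sumE; case: eqP => _; first by lra.
set a := 2 * _ - _ + 1; set D := a ^+ 2 + _.
suff: 0 < a + Num.sqrt D by rewrite /a; lra.
(* If [a <= 0] then [d_1 >= 2 d_l + 1 > d_l], hence [S > 0] and the square root strictly exceeds
   [|a|]. *)
have [a_gt0|a_le0] := ltP 0 a; first by rewrite ltr_wpDr// sqrtr_ge0.
have dl_ge0 : 0 <= (d l)%:R :> R by [].
have S_gt0 : 0 < S%:R :> R by rewrite /a in a_le0; lra.
suff: `|a| < Num.sqrt D by rewrite ler0_norm//; lra.
rewrite -sqrtr_sqr ltr_sqrt /D; first by lra.
by rewrite ltr_wpDl ?sqr_ge0//; lra.
Qed.

Lemma phi_root :
  (phi R d l - 2 * (d l)%:R) * (phi R d l - (d ord0)%:R + 1) = 2 * S%:R.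
Proof.
rewrite /phi truncated_sumE; case: eqP => [l0|_].
  suff -> : S = 0%N by rewrite l0; ring.
  by rewrite /S l0 big1// => i _; apply/eqP; rewrite subn_eq0 d_sorted.
set D := _ ^+ 2 + _.
have : Num.sqrt D ^+ 2 = D.
  by rewrite sqr_sqrtr// addr_ge0 ?sqr_ge0// mulr_ge0.
set r := Num.sqrt D; rewrite /D => Dr.
(* With [a = 2 d_l - d_1 + 1], the factors are [(r - a) / 2] and [(r + a) / 2], so four times their
   product is [r ^ 2 - a ^ 2 = 8 S]. *)
apply: (@mulfI _ 4); first by rewrite pnatr_eq0.
rewrite (_ : 4 * (2 * S%:R) = 8 * S%:R); last by ring.
rewrite -[8 * _](addKr ((2 * (d l)%:R - (d ord0)%:R + 1) ^+ 2)) -Dr.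
by field.
Qed.

End Phi.

(** * The signless Laplacian, its test vector and the equality case *)

Section SignlessLaplacian.
Context {R : realType} {n : nat}.
Variable E : rel 'I_n.+1.
Hypothesis E_simple : irreflexive E.

Let d := outdegree E.
Hypothesis outdeg_sorted : forall i j : 'I_n.+1, (i <= j)%N -> (d j <= d i)%N.

Let Q := signless_laplacian R E.

Lemma signless_laplacian_ge0 i j : 0 <= Q i j.
Proof. by rewrite !mxE addr_ge0// mulrn_wge0. Qed.

Lemma signless_laplacian_gt0 i j : E i j -> 0 < Q i j.
Proof. by move=> Eij; rewrite !mxE Eij ltr_wpDl// mulrn_wge0. Qed.

Lemma map_signless_laplacian :
  signless_laplacian R[i] E = map_mx (real_complex R) Q.
Proof.
by apply/matrixP => i j; rewrite !mxE rmorphD rmorphMn /= !rmorph_nat.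
Qed.

Lemma signless_laplacian_mul (x : 'I_n.+1 -> R) i :
  \sum_j Q i j * x j = (d i)%:R * x i + \sum_(j | E i j) x j.
Proof.
under eq_bigr do rewrite !mxE mulrDl; rewrite big_split /=; congr (_ + _).
  rewrite (bigD1 i)//= eqxx big1 ?addr0// => j /negPf ji.
  by rewrite eq_sym ji mul0r.
rewrite [RHS]big_mkcond; apply: eq_bigr => j _.
by case: (E i j); rewrite ?mul1r ?mul0r.
Qed.

Variable l : 'I_n.+1.
Let phil := phi R d l.
Let c := 2 / (phil - (d ord0)%:R + 1).

Definition test_vector i : R := 1 + c * (d i - d l)%:R.

(** The three terms penalize, in order, an outdegree strictly between [d_l] and [d_1], an outdegree
    below [d_l], and a missing arc to a vertex of outdegree above [d_l]. *)
Definition slack i : R :=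
  ((d ord0)%:R - (d i)%:R) * c * (d i - d l)%:R + 2 * (d l - d i)%:R
  + \sum_(j | (j != i) && ~~ E i j) c * (d j - d l)%:R.

Lemma test_scale_gt0 : 0 < c.
Proof. by rewrite divr_gt0// phi_sub_gt0. Qed.

Lemma test_vector_gt0 i : 0 < test_vector i.
Proof. by rewrite ltr_pwDl// mulr_ge0// ltW// test_scale_gt0. Qed.

Lemma slackE i : phil * test_vector i - \sum_j Q i j * test_vector j = slack i.
Proof.
have den_neq0 : phil - (d ord0)%:R + 1 != 0.
  by rewrite gt_eqF// phi_sub_gt0.
(* The quadratic satisfied by [phil] evaluates the total of [x_j - 1]. Removing vertex [i] and its
   non-out-neighbours then leaves the sum over out-neighbours that occurs in [Q x]. *)
have sumY : \sum_j c * (d j - d l)%:R = phil - 2 * (d l)%:R.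
  rewrite -mulr_sumr -natr_sum /c mulrAC -phi_root//.
  by rewrite -/phil mulfK.
rewrite signless_laplacian_mul /test_vector big_split /=.
have -> : \sum_(j | E i j) 1 = (d i)%:R :> R.
  by rewrite /d /outdegree cardsE -sumr_const.
have := sumY; rewrite (bigD1 i)//= (bigID (E i))/=.
rewrite (eq_bigl (E i)); last first.
  by move=> j; case: eqP => // ->; rewrite E_simple.
rewrite /slack; set N := \sum_(j | _ && ~~ _) _; set A := \sum_(j | E i j) _.
move=> /(canRL (addKr _))/(canRL (addrK _)) ->.
have cE : c * (phil - (d ord0)%:R + 1) = 2 by rewrite divfK.
have [dil|/ltnW dli] := leqP (d l) (d i).
  have /eqP -> : (d l - d i == 0)%N by rewrite subn_eq0.
  have e_eq : (d i)%:R = (d i - d l)%:R + (d l)%:R :> R by rewrite natrB// subrK.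
  (* The difference of the two sides is a multiple of [c * (phil - d_1 + 1) - 2], which is 0 by the
     choice of [c]. *)
  transitivity ((c * (phil - (d ord0)%:R + 1) - 2) * (d i - d l)%:R
    + (((d ord0)%:R - (d i)%:R) * c * (d i - d l)%:R + 2 * 0 + N)).
    rewrite e_eq; move: (d i - d l)%:R => e.
    ring.
  by rewrite cE subrr mul0r add0r.
have /eqP -> : (d i - d l == 0)%N by rewrite subn_eq0.
rewrite natrB//; ring.
Qed.

Lemma slack_terms_ge0 i :
  [/\ 0 <= ((d ord0)%:R - (d i)%:R) * c * (d i - d l)%:R,
      0 <= 2 * (d l - d i)%:R :> R &
      0 <= \sum_(j | (j != i) && ~~ E i j) c * (d j - d l)%:R].
Proof.
have c_ge0 := ltW test_scale_gt0.
split; last by apply: sumr_ge0 => j _; rewrite mulr_ge0.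
  by do 2![apply: mulr_ge0 => //]; rewrite subr_ge0 ler_nat outdeg_sorted.
by rewrite mulr_ge0.
Qed.

Lemma slack_ge0 i : 0 <= slack i.
Proof. by have [? ? ?] := slack_terms_ge0 i; rewrite !addr_ge0. Qed.

Lemma slack_eq0P i :
  slack i = 0 <->
  [/\ (d l < d i)%N -> d i = d ord0, (d l <= d i)%N &
      forall j, j != i -> (d l < d j)%N -> E i j].
Proof.
have := slack_terms_ge0 i; have := test_scale_gt0; rewrite /slack.
move: (c) => k k_gt0 [t1 t2 t3]; split.
  move=> /eqP; rewrite !paddr_eq0 ?addr_ge0// => /andP[/andP[]].
  rewrite !mulf_eq0 (gt_eqF k_gt0) orbF subr_eq0 !pnatr_eq0 eqr_nat.
  move=> e1; rewrite /= !subn_eq0 in e1 *; move=> e2 e3; split=> //.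
    by move=> lt_li; move: e1; rewrite leqNgt lt_li orbF => /eqP.
  move=> j ji lt_lj; apply/negPn/negP => nE.
  move: e3; rewrite psumr_eq0; last by move=> m _; rewrite mulr_ge0// ltW.
  move=> /allP/(_ j); rewrite mem_index_enum ji nE /= => /(_ isT).
  by rewrite mulf_eq0 (gt_eqF k_gt0) /= pnatr_eq0 subn_eq0 leqNgt lt_lj.
move=> [h1 h2 h3].
have /eqP -> : (d l - d i == 0)%N by rewrite subn_eq0.
rewrite big1 ?mulr0 ?addr0.
  have [/h1->|] := ltnP (d l) (d i); first by rewrite subrr !mul0r.
  by rewrite -subn_eq0 => /eqP->; rewrite mulr0.
move=> j /andP[ji nE]; have [/(h3 _ ji)|] := ltnP (d l) (d j).
  by rewrite (negPf nE).
by rewrite -subn_eq0 => /eqP->; rewrite mulr0.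
Qed.

Lemma signless_spectral_radius_le_phi : signless_spectral_radius R E <= phil.
Proof.
rewrite /signless_spectral_radius map_signless_laplacian.
have [[z z_eig <-] _] := spectral_radius_max (map_mx (real_complex R) Q).
apply: (eigenvalue_norm_le _ _ _ _ signless_laplacian_ge0 test_vector_gt0 _ z_eig).
by move=> i; rewrite -subr_ge0 slackE slack_ge0.
Qed.

Lemma slack_eq0_of_radius_eq :
  strongly_connected E -> signless_spectral_radius R E = phil ->
  forall i, slack i = 0.
Proof.
rewrite /signless_spectral_radius map_signless_laplacian => Econ.
have [[z z_eig <-] _] := spectral_radius_max (map_mx (real_complex R) Q).
move=> Dz i; apply/eqP; rewrite -slackE subr_eq0 -Dz eq_sym; apply/eqP.
apply: (eigenvalue_norm_eq _ _ _ _ signless_laplacian_ge0 test_vector_gt0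
         signless_laplacian_gt0 Econ _ z_eig).
by move=> k; rewrite Dz -subr_ge0 slackE slack_ge0.
Qed.

(** Zero slack turns the test vector into a right eigenvector for [phil], so the radius is at least
    [|phil|]. *)
Lemma radius_eq_of_slack_eq0 :
  (forall i, slack i = 0) -> signless_spectral_radius R E = phil.
Proof.
move=> slack0; apply/eqP; rewrite eq_le signless_spectral_radius_le_phi /=.
rewrite /signless_spectral_radius map_signless_laplacian.
have [_ /(_ phil%:C%C) max] := spectral_radius_max (map_mx (real_complex R) Q).
apply: le_trans (max _).
  by rewrite /= expr0n addr0 sqrtr_sqr ler_norm.
apply: (eigenvalue_of_right_eigenvector _ test_vector).
  by exists ord0; rewrite gt_eqF// test_vector_gt0.
by move=> i; apply/eqP; rewrite eq_sym -subr_eq0 slackE slack0.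
Qed.

(** Without loops the in-neighbours of [i] lie in the complement of [i], and equal cardinality
    forces equality of the two sets. *)
Lemma indegree_full i :
  indegree E i = (n.+1 - 1)%N <-> forall j, i != j -> E j i.
Proof.
have sub : [set j | E j i] \subset [set~ i].
  apply/subsetP => j; rewrite !inE.
  by apply: contraTneq => ->; rewrite E_simple.
have cardC : #|[set~ i]| = (n.+1 - 1)%N by rewrite cardsC1 card_ord subn1.
split.
  move=> /eqP; rewrite -cardC; rewrite (subset_leqif_cards sub).
  by move=> /eqP/setP Ei j ij; have := Ei j; rewrite !inE eq_sym ij.
move=> Ei; rewrite -cardC; apply/eqP; rewrite (subset_leqif_cards sub).
rewrite eqEsubset sub; apply/subsetP => j; rewrite !inE eq_sym; exact: Ei.
Qed.

(** Zero slack makes [d_l] the least outdegree and lets only [d_1] occur above it, so at most two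
    values remain. Indices start at 0, so [t] and [l] are both shifted by one and [1 <= t] stands
    for the usual [2 <= t]. *)
Lemma slack_eq0_iff :
  (forall i, slack i = 0) <->
  (forall i j : 'I_n.+1, d i = d j) \/
  (exists t : 'I_n.+1,
    [/\ (1 <= t)%N /\ (t <= l)%N,
        forall i : 'I_n.+1, (i < t)%N -> d i = d ord0,
        (d t < d ord0)%N,
        forall i : 'I_n.+1, (t <= i)%N -> d i = d t
      & forall i : 'I_n.+1, (i < t)%N -> indegree E i = (n.+1 - 1)%N]).
Proof.
split=> [slack0|].
  have top i : (d l < d i)%N -> d i = d ord0 by have /slack_eq0P[] := slack0 i.
  have dl_min i : (d l <= d i)%N by have /slack_eq0P[] := slack0 i.
  have arc i j : j != i -> (d l < d j)%N -> E i j.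
    by have /slack_eq0P[_ _] := slack0 i; apply.
  have [d0|d0] := eqVneq (d ord0) (d l).
    left; suff dE i : d i = d l by move=> i j; rewrite !dE.
    by apply/eqP; rewrite eqn_leq dl_min andbT -d0 outdeg_sorted.
  right.
  (* [t] is the first index with outdegree [d_l]; it is at most [l] since [l] qualifies. *)
  have [t /eqP dt t_min] := @arg_minnP _ l (fun i => d i == d l) val (eqxx _).
  have lt_top (i : 'I_n.+1) : (i < t)%N -> (d l < d i)%N.
    move=> lt_it; rewrite ltn_neqAle dl_min andbT eq_sym.
    by apply: contraL lt_it => /t_min; rewrite -leqNgt.
  exists t; split.
  - split; last exact: t_min.
    rewrite lt0n; apply: contra d0 => /eqP t0.
    by rewrite -dt; apply/eqP; congr d; apply: val_inj.
  - by move=> i /lt_top/top.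
  - by rewrite dt ltn_neqAle eq_sym d0 outdeg_sorted.
  - move=> i ti; apply/eqP; rewrite eqn_leq outdeg_sorted//.
    by rewrite dt dl_min.
  - by move=> i it; apply/indegree_full => j ij; exact: arc ij (lt_top _ it).
case=> [dE i|[t [[t_gt0 tl] top dt bot ind]] i]; apply/slack_eq0P.
  rewrite (dE i l) ltnn leqnn; split=> // j _.
  by rewrite (dE j l) ltnn.
(* As [t <= l], the value [d_l] is that of the constant tail, so larger outdegrees occur only before
   [t]. *)
have dl := bot _ tl; have gtP j : (d l < d j)%N -> (j < t)%N.
  by rewrite dl ltnNge; apply: contraNltn => /bot ->.
split; first by move/gtP/top.
  rewrite dl; have [/top->|/bot->//] := ltnP i t; exact: ltnW.
by move=> j ji /gtP/ind/indegree_full; apply.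
Qed.

End SignlessLaplacian.

Theorem theorem2p7 (R : realType) (n : nat) (E : rel 'I_n.+1)
    (n_ge2 : (2 <= n.+1)%N)
    (E_simple : irreflexive E)
    (outdeg_sorted : forall i j : 'I_n.+1,
        (i <= j)%N -> (outdegree E j <= outdegree E i)%N)
    (s : 'I_n.+1)
    (s_min : forall l : 'I_n.+1, phi R (outdegree E) s <= phi R (outdegree E) l) :
  signless_spectral_radius R E <= phi R (outdegree E) s /\
  (strongly_connected E ->
    (signless_spectral_radius R E = phi R (outdegree E) s <->
      (forall i j : 'I_n.+1, outdegree E i = outdegree E j) \/
      (exists t : 'I_n.+1,
        [/\ (1 <= t)%N /\ (t <= s)%N,
            forall i : 'I_n.+1, (i < t)%N -> outdegree E i = outdegree E ord0,
            (outdegree E t < outdegree E ord0)%N,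
            forall i : 'I_n.+1, (t <= i)%N -> outdegree E i = outdegree E t
          & forall i : 'I_n.+1, (i < t)%N -> indegree E i = (n.+1 - 1)%N]))).
Proof.
split; first exact: signless_spectral_radius_le_phi.
move=> Econ; apply: iff_trans (slack_eq0_iff (R := R) _ E_simple outdeg_sorted s).
split; first exact: slack_eq0_of_radius_eq.
exact: radius_eq_of_slack_eq0.
Qed.
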